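(* Let $G$ and $H$ be finite simple connected graphs, and let $\odot(G,H)$ be their corona. Then $$M^{ev}(\odot(G,H)) = M^{ev}(G) + n(G)M^{ev}(H) + 5n(H)M_1(G) + 2n(G)M_1(H) + 8n(H)^2m(G) + n(G)n(H)(n(H)+1)^2 + n(G)m(H) + 4n(H)m(G) - 6n(G)\eta(H) - 12n(H)\eta(G).$$
   Context: For a finite simple graph $K$: $V(K)$ and $E(K)$ are its vertex and edge sets, $n(K)=|V(K)|$, $m(K)=|E(K)|$, $d_K(x)$ is the degree of the vertex $x$, $N[x]$ is the closed neighbourhood of $x$, and $\eta(K)$ is the total number of triangles in $K$. For an edge $e=xy$ of $K$, the edge-vertex degree is $deg^{ev}_K(e)=|N[x]\cup N[y]|$; equivalently $deg^{ev}_K(e)=d_K(x)+d_K(y)-\eta_K(e)$, where $\eta_K(e)$ is the number of triangles of $K$ containing $e$. The $ev$-degree Zagreb index is $M^{ev}(K)=\sum_{e\in E(K)} deg^{ev}_K(e)^2$. The first Zagreb index is $M_1(K)=\sum_{x\in V(K)} d_K(x)^2$. The corona $\odot(G,H)$ is obtained by taking one copy of $G$ and $n(G)$ disjoint copies of $H$ and joining every vertex of the $i$th copy of $H$ to the $i$th vertex of $G$, for $1\le i\le n(G)$. *)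

(* Defs.v *)
From HB Require Import structures.
From mathcomp Require Import all_boot all_order all_algebra.

Set Implicit Arguments.
Unset Strict Implicit.
Unset Printing Implicit Defensive.

Record sgraph := SGraph {
  vertex :> finType;
  adj : rel vertex;
  adj_sym : symmetric adj;
  adj_irr : irreflexive adj
}.

(* The graph with no vertices is not considered connected. *)
Definition connected_graph (K : sgraph) : Prop :=
  0 < #|K| /\ forall x y : K, connect (@adj K) x y.

(* An edge is the two-element set of its endpoints, so that every edge is
   counted exactly once. *)
Definition edges (K : sgraph) : {set {set K}} :=
  [set [set x; y] | x in K, y in K & adj x y].

Definition nb_vertices (K : sgraph) : nat := #|K|.

Definition nb_edges (K : sgraph) : nat := #|edges K|.

Definition degree (K : sgraph) (x : K) : nat := #|[set y | adj x y]|.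

Definition closed_nbh (K : sgraph) (x : K) : {set K} := x |: [set y | adj x y].

Definition triangles (K : sgraph) : {set {set K}} :=
  [set t : {set K} | (#|t| == 3) &&
     [forall x in t, forall y in t, (x != y) ==> adj x y]].

Definition nb_triangles (K : sgraph) : nat := #|triangles K|.

Definition ev_degree (K : sgraph) (e : {set K}) : nat :=
  #|\bigcup_(x in e) closed_nbh x|.

Lemma ev_degreeE (K : sgraph) (x y : K) :
  ev_degree [set x; y] = #|closed_nbh x :|: closed_nbh y|.
Proof. by rewrite /ev_degree bigcup_setU !big_set1. Qed.

Definition ev_zagreb (K : sgraph) : nat :=
  \sum_(e in edges K) ev_degree e ^ 2.

Definition first_zagreb (K : sgraph) : nat := \sum_(x : K) degree x ^ 2.

(* inl x is the vertex x of G; inr (x, u) is the vertex u of the copy of H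
   attached to x. *)
Definition corona_adj (G H : sgraph) : rel (G + G * H)%type :=
  fun a b =>
    match a, b with
    | inl x, inl y => adj x y
    | inl x, inr (y, _) => x == y
    | inr (x, _), inl y => x == y
    | inr (x, u), inr (y, v) => (x == y) && adj u v
    end.

Lemma corona_sym (G H : sgraph) : symmetric (@corona_adj G H).
Proof.
move=> [x|[x u]] [y|[y v]] /=.
- exact: adj_sym.
- exact: eq_sym.
- exact: eq_sym.
- by rewrite eq_sym adj_sym.
Qed.

Lemma corona_irr (G H : sgraph) : irreflexive (@corona_adj G H).
Proof. by move=> [x|[x u]] /=; rewrite adj_irr ?andbF. Qed.

Definition corona (G H : sgraph) : sgraph :=
  SGraph (@corona_sym G H) (@corona_irr G H).

(* Main.v *)
Require Import Defs.
From mathcomp Require Import all_boot all_order all_algebra.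
From mathcomp Require Import ring zify.

(** The edges of the corona fall into three classes, and the closed
neighbourhood of an edge of each class can be read off directly.
- An edge [e] of [G] sees what it sees in [G] and the two copies of [H] at its
  ends, so its ev-degree grows by [2 n(H)].
- An edge of a copy of [H] sees what it sees in [H] and the vertex of [G] to
  which the copy is attached, so its ev-degree grows by [1].
- An edge joining [x] to its copy of [H] sees the closed neighbourhood of [x] in
  [G] and the whole copy, so its ev-degree is [d(x) + 1 + n(H)].

Squaring and summing over the first two classes leaves the linear sums
[\sum_e deg^ev(e)] over [G] and [H]. By inclusion-exclusion [deg^ev(xy)] is
[d(x) + d(y)] minus the number of common neighbours of [x] and [y], that is, of
triangles on [xy]; each vertex [x] lies on [d(x)] edges and each triangle
contains three, so the linear sum is [M_1 - 3 eta] ([sum_ev_degree]). The third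
class contributes [n(H) \sum_x (d(x) + n(H) + 1)^2], where the cross term is
given by the handshake lemma. Adding up gives the formula.

Sums over edges are compared by way of sums over ordered pairs of adjacent
vertices, which count every edge twice ([sum_arcs]): ordered pairs split along
the disjoint union of vertices of the corona, unordered ones do not. *)

Set Implicit Arguments.
Unset Strict Implicit.
Unset Printing Implicit Defensive.

(** * Edges, arcs and triangles of a graph *)

Lemma set2_eq (T : finType) (x y a b : T) :
  ([set a; b] == [set x; y]) =
    ((a, b) == (x, y)) || ((a, b) == (y, x)).
Proof.
apply/eqP/orP => [E|[/eqP[-> ->]|/eqP[-> ->]] //]; last by rewrite setUC.
have /[!inE] ax : a \in [set x; y] by rewrite -E set21.
have /[!inE] bx : b \in [set x; y] by rewrite -E set22.
have /[!inE] xa : x \in [set a; b] by rewrite E set21.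
have /[!inE] ya : y \in [set a; b] by rewrite E set22.
move: ax bx xa ya; rewrite !xpair_eqE (eq_sym x) (eq_sym x) (eq_sym y) (eq_sym y).
by case: (a == x) (a == y) (b == x) (b == y) => [] [] [] []; auto.
Qed.

Section Graph.
Variable K : sgraph.
Implicit Types (x y z : K) (e t : {set K}).

Lemma adj_neq x y : adj x y -> x != y.
Proof. by apply: contraTneq => ->; rewrite adj_irr. Qed.

Lemma edgesP e : reflect (exists x y, adj x y /\ e = [set x; y]) (e \in edges K).
Proof.
apply: (iffP imset2P) => [[x y _]|[x [y [xy ->]]]].
  by rewrite inE => /andP[_ xy] ->; exists x, y.
by exists x y; rewrite // inE.
Qed.

Lemma mem_edges x y : adj x y -> [set x; y] \in edges K.
Proof. by move=> xy; apply/edgesP; exists x, y. Qed.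

Lemma card_edge e : e \in edges K -> #|e| = 2.
Proof. by case/edgesP=> x [y [xy ->]]; rewrite cards2 adj_neq. Qed.

(** Each edge is traversed by exactly two arcs, one in each direction. *)
Lemma sum_arcs (F : {set K} -> nat) :
  \sum_x \sum_(y | adj x y) F [set x; y] = 2 * \sum_(e in edges K) F e.
Proof.
rewrite pair_big_dep /=.
rewrite (partition_big (fun p => [set p.1; p.2]) (mem (edges K))) /=; last first.
  by case=> x y; apply: mem_edges.
rewrite big_distrr /=; apply: eq_bigr => e /edgesP[x [y [xy ->]]].
rewrite (eq_bigl (mem [set (x, y); (y, x)])) => [|[a b]] /=.
  rewrite big_setU1 /= ?big_set1 /= 1?[[set y; x]]setUC ?mul2n ?addnn //.
  by rewrite inE xpair_eqE (negPf (adj_neq xy)).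
rewrite !inE set2_eq andb_idl //.
by case/orP=> /eqP[-> ->] //; rewrite adj_sym.
Qed.

Lemma sum_degree : \sum_(x : K) degree x = 2 * nb_edges K.
Proof.
rewrite /nb_edges -sum1_card -(sum_arcs (fun=> 1)).
by apply: eq_bigr => x _; rewrite sum1_card /degree cardsE.
Qed.

(** Inclusion-exclusion; when [x] and [y] are adjacent, closing the
neighbourhoods adds nothing to their union. *)
Lemma ev_degree_adj x y : adj x y ->
  ev_degree [set x; y] + #|[set z | adj x z && adj y z]| = degree x + degree y.
Proof.
move=> xy; rewrite ev_degreeE /degree -[RHS]cardsUI; congr (_ + _); apply: eq_card.
  move=> z; rewrite !inE; case: (eqVneq z x) => [->|_] /=.
    by rewrite (adj_sym y) xy orbT.
  by case: (eqVneq z y) => [->|_] //=; rewrite xy.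
by move=> z; rewrite !inE.
Qed.

Lemma sub_triangle_edge t e :
  t \in triangles K -> e \subset t -> #|e| = 2 -> e \in edges K.
Proof.
rewrite inE => /andP[_ /forall_inP tP] /subsetP et /eqP/cards2P[x [y [xy E]]].
have [xt yt]: x \in t /\ y \in t by split; apply: et; rewrite E !inE eqxx ?orbT.
have /forall_inP/(_ y yt) := tP x xt; rewrite xy => /= adj_xy.
by rewrite E mem_edges.
Qed.

(** Adding a common neighbour of the ends of an edge completes it to a
triangle, and every triangle on the edge arises once in this way. *)
Lemma card_common_nbh x y : adj x y ->
  #|[set z | adj x z && adj y z]| = #|[set t in triangles K | [set x; y] \subset t]|.
Proof.
move=> xy; have nxy := adj_neq xy.
have notin z : adj x z && adj y z -> z \notin [set x; y].
  by case/andP=> /adj_neq xz /adj_neq yz; rewrite !inE !(eq_sym z) negb_or xz.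
rewrite -(card_in_imset (f := fun z => z |: [set x; y])); last first.
  move=> z w; rewrite !inE => /notin zP _ E.
  have: z \in w |: [set x; y] by rewrite -E setU11.
  by rewrite in_setU1 (negPf zP) orbF => /eqP.
apply: eq_card => t; rewrite [RHS]inE; apply/imsetP/andP => [[z]|[tT xyt]].
  rewrite inE => zP ->; rewrite subsetUr inE; split=> //.
  rewrite cardsU1 notin // cards2 nxy /=.
  case/andP: zP => xz yz.
  apply/forall_inP=> a aP; apply/forall_inP=> b bP; apply/implyP.
  by move: aP bP; rewrite !inE => /or3P[] /eqP-> /or3P[] /eqP->;
    rewrite ?eqxx // => _; rewrite // adj_sym.
have := tT; rewrite inE => /andP[/eqP t3 /forall_inP tP].
have /cards1P[z zP] : #|t :\: [set x; y]| == 1.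
  by rewrite cardsD (setIidPr xyt) t3 cards2 nxy.
have zt : z \in t :\: [set x; y] by rewrite zP set11.
have tE : t = z |: [set x; y] by rewrite -zP setUC -{1}(setID t [set x; y]) (setIidPr xyt).
exists z => //; move: zt; rewrite !inE negb_or => /andP[/andP[zx zy] zt].
have adjz a : a \in [set x; y] -> z != a -> adj a z.
  move=> /(subsetP xyt) at_ za; have /forall_inP/(_ z zt) := tP a at_.
  by rewrite eq_sym za.
by rewrite !adjz ?inE ?eqxx ?orbT.
Qed.

(** Double counting: a triangle contains ['C(3, 2)] two-element sets, and all of
them are edges. *)
Lemma sum_edge_triangles :
  \sum_(e in edges K) #|[set t in triangles K | e \subset t]| = 3 * nb_triangles K.
Proof.
under eq_bigr => e _ do rewrite -sum1_card big_set big_mkcondr.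
rewrite exchange_big /= mulnC /nb_triangles -sum_nat_const.
apply: eq_bigr => t tT; rewrite -big_mkcondr sum1_card.
have /eqP t3 : #|t| == 3 by move: tT; rewrite inE => /andP[].
rewrite -[3]/('C(3, 2)) -t3 -cards_draws cardsE.
apply: eq_card => e; rewrite !unfold_in /=; apply/andP/andP => [[eE et]|[et /eqP e2]].
  by rewrite et card_edge.
by split=> //; apply: (sub_triangle_edge tT).
Qed.

Lemma sum_ev_degree :
  \sum_(e in edges K) ev_degree e + 3 * nb_triangles K = first_zagreb K.
Proof.
rewrite -sum_edge_triangles -big_split /=; apply/eqP.
rewrite -(eqn_pmul2l (isT : 0 < 2)) -sum_arcs; apply/eqP.
transitivity (\sum_x \sum_(y : K | adj x y) (degree x + degree y)).
  by apply: eq_bigr => x _; apply: eq_bigr => y xy; rewrite -card_common_nbh ?ev_degree_adj.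
have sumx : \sum_x \sum_(y : K | adj x y) degree x = first_zagreb K.
  by apply: eq_bigr => x _; rewrite sum_nat_const -[X in X * _]cardsE.
under eq_bigr => x _ do rewrite big_split /=.
rewrite big_split /= sumx mul2n -addnn; congr (_ + _).
rewrite (exchange_big_dep predT) //= -sumx.
by apply: eq_bigr => y _; apply: eq_bigl => x; rewrite adj_sym.
Qed.

(** In the corona every edge of a given kind gains the same amount [c], equal to
[2 n(H)] for edges of [G] and to [1] for edges of a copy of [H]. The triangle term
is on the left because the identity lives in [nat]. *)
Lemma sum_ev_degree_shift (c : nat) :
  \sum_(e in edges K) (ev_degree e + c) ^ 2 + 6 * c * nb_triangles K =
  ev_zagreb K + 2 * c * first_zagreb K + c ^ 2 * nb_edges K.
Proof.
rewrite -sum_ev_degree.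
under eq_bigr => e _ do rewrite sqrnD.
rewrite 2!big_split sum_nat_const -/(ev_zagreb K) -/(nb_edges K).
have <- : 2 * ((\sum_(e in edges K) ev_degree e) * c) =
    \sum_(e in edges K) 2 * (ev_degree e * c) by rewrite big_distrl big_distrr.
rewrite /=; ring.
Qed.

End Graph.

(** * Edges of the corona and their closed neighbourhoods *)

Lemma card_sum_set (S T : finType) (A : {set S + T}) :
  #|A| = #|inl @^-1: A| + #|inr @^-1: A|.
Proof.
rewrite -!sum1_card big_sumType /=.
by congr (_ + _); apply: eq_bigl => a; rewrite inE.
Qed.

Section Corona.
Variables G H : sgraph.
Notation C := (corona G H).

Let base (x : G) : C := inl x.
Let copy (x : G) (u : H) : C := inr (x, u).

(** Each joining edge is met twice as an arc, once from either end: these are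
the two middle terms that [arcsG] and [arcsH] contribute. *)
Lemma sum_edges_corona (F : {set C} -> nat) :
  \sum_(e in edges C) F e =
    \sum_(e in edges G) F (base @: e)
    + \sum_(x : G) \sum_(u : H) F [set base x; copy x u]
    + \sum_(x : G) \sum_(e in edges H) F (copy x @: e).
Proof.
have row (P : pred (G * H)) (x : G) (Q : pred H) (f : G * H -> nat) :
    (forall y v, P (y, v) = (x == y) && Q v) ->
    \sum_(p | P p) f p = \sum_(v | Q v) f (x, v).
  move=> PE; transitivity (\sum_(p | (x == p.1) && Q p.2) f (p.1, p.2)).
    by apply: eq_big => -[].
  rewrite -(pair_big (eq_op x) Q (fun y v => f (y, v))) /=.
  by rewrite (big_pred1 x) // => y; rewrite /= eq_sym.
have arcsG (x : G) : \sum_(b : C | adj (base x) b) F [set base x; b] =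
    \sum_(y | adj x y) F (base @: [set x; y]) + \sum_u F [set base x; copy x u].
  rewrite big_sumType /= (row _ x predT) => [|y v]; rewrite ?andbT //.
  by congr (_ + _); apply: eq_bigr => y _; rewrite imsetU1 imset_set1.
have arcsH (x : G) (u : H) : \sum_(b : C | adj (copy x u) b) F [set copy x u; b] =
    F [set base x; copy x u] + \sum_(v | adj u v) F (copy x @: [set u; v]).
  rewrite big_sumType /= (big_pred1 x) => [|y]; last by rewrite /= eq_sym.
  rewrite (row _ x (adj u)) // setUC; congr (_ + _).
  by apply: eq_bigr => v _; rewrite imsetU1 imset_set1.
apply/eqP; rewrite -(eqn_pmul2l (isT : 0 < 2)) -sum_arcs big_sumType /=.
rewrite (eq_bigr _ (fun x _ => arcsG x)) big_split /= (sum_arcs (fun e => F (base @: e))).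
rewrite (eq_bigr (fun p => F [set base p.1; copy p.1 p.2] +
    \sum_(v | adj p.2 v) F (copy p.1 @: [set p.2; v]))) => [|[x u] _]; last exact: arcsH.
rewrite big_split /=.
rewrite -(pair_bigA _ (fun x u => F [set base x; copy x u])) /=.
rewrite -(pair_bigA _ (fun x u => \sum_(v | adj u v) F (copy x @: [set u; v]))) /=.
under [X in _ + (_ + X)]eq_bigr => x _ do rewrite (sum_arcs (fun e => F (copy x @: e))).
rewrite -big_distrr /=; apply/eqP; lia.
Qed.

(** Distinct vertices of [G] are attached to disjoint copies of [H], so each
vertex of [e] contributes a whole copy. *)
Lemma ev_degree_base (e : {set G}) :
  ev_degree (base @: e) = ev_degree e + #|e| * #|H|.
Proof.
rewrite /ev_degree card_sum_set -[#|H|]cardsT -cardsX; congr (_ + _); apply: eq_card.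
  move=> y; rewrite inE; apply/bigcupP/bigcupP => [[_ /imsetP[x xe ->]]|[x xe]].
    by rewrite !inE => xy; exists x; rewrite ?inE.
  by rewrite !inE => xy; exists (base x); rewrite ?imset_f ?inE.
case=> y v; rewrite !inE andbT; apply/bigcupP/idP => [[_ /imsetP[x xe ->]]|ye].
  by rewrite !inE /= => /eqP <-.
by exists (base y); rewrite ?imset_f // !inE /=.
Qed.

(** All vertices of one copy of [H] have the same single neighbour in [G]; it is
counted as soon as [e] has a vertex. *)
Lemma ev_degree_copy (x : G) (e : {set H}) :
  e != set0 -> ev_degree (copy x @: e) = ev_degree e + 1.
Proof.
case/set0Pn=> u ue.
rewrite [LHS]card_sum_set addnC.
have -> : ev_degree e + 1 = #|setX [set x] (\bigcup_(w in e) closed_nbh w)| + #|[set x]|.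
  by rewrite cardsX !cards1 mul1n.
congr (_ + _); apply: eq_card.
  case=> y v; rewrite !inE /=; apply/bigcupP/andP => [[_ /imsetP[w we ->]]|[/eqP-> /bigcupP[w we]]].
    rewrite !inE /= => /orP[/eqP[-> ->]|/andP[/eqP-> wv]]; split=> //.
      by apply/bigcupP; exists w; rewrite ?inE ?eqxx.
    by apply/bigcupP; exists w; rewrite ?inE ?wv ?orbT.
  rewrite !inE => wv; exists (copy x w); rewrite ?imset_f // !inE /= eqxx.
  by case/orP: wv => [/eqP->|->]; rewrite ?eqxx ?orbT.
move=> y; rewrite !inE; apply/bigcupP/idP => [[_ /imsetP[w we ->]]|/eqP->].
  by rewrite !inE /= eq_sym.
by exists (copy x u); rewrite ?imset_f // !inE /=.
Qed.

(** The neighbourhood of the end in the copy lies in what the end in [G] already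
sees: the closed neighbourhood of [x] in [G] and the whole copy. *)
Lemma ev_degree_joining (x : G) (u : H) :
  ev_degree [set base x; copy x u] = degree x + (#|H| + 1).
Proof.
rewrite ev_degreeE card_sum_set.
have -> : degree x + (#|H| + 1) = #|closed_nbh x| + #|setX [set x] [set: H]|.
  by rewrite cardsX cards1 cardsT cardsU1 inE adj_irr /degree /=; lia.
congr (_ + _); apply: eq_card.
  move=> y; rewrite !inE /= (eq_sym x y).
  have -> : (inl y == base x) = (y == x) by [].
  by case: (y == x); rewrite ?orbT ?orbF.
case=> y v; rewrite !inE /= andbT (eq_sym x y).
have -> : (inr (y, v) == copy x u) = (y == x) && (v == u) by [].
by case: (y == x).
Qed.

End Corona.

(** * The ev-degree Zagreb index of the corona *)

Local Open Scope ring_scope.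

(* The identity is stated in int, so that the subtractions are exact. *)
Theorem theorem3p4 (G H : sgraph)
    (connG : connected_graph G) (connH : connected_graph H) :
  (ev_zagreb (corona G H))%:Z =
    (ev_zagreb G)%:Z
    + (nb_vertices G)%:Z * (ev_zagreb H)%:Z
    + 5 * (nb_vertices H)%:Z * (first_zagreb G)%:Z
    + 2 * (nb_vertices G)%:Z * (first_zagreb H)%:Z
    + 8 * (nb_vertices H)%:Z ^+ 2 * (nb_edges G)%:Z
    + (nb_vertices G)%:Z * (nb_vertices H)%:Z * ((nb_vertices H)%:Z + 1) ^+ 2
    + (nb_vertices G)%:Z * (nb_edges H)%:Z
    + 4 * (nb_vertices H)%:Z * (nb_edges G)%:Z
    - 6 * (nb_vertices G)%:Z * (nb_triangles H)%:Z
    - 12 * (nb_vertices H)%:Z * (nb_triangles G)%:Z.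
Proof.
set nG := nb_vertices G; set nH := nb_vertices H.
have baseE : (\sum_(e in edges G) ev_degree ((inl : G -> corona G H) @: e) ^ 2 =
    \sum_(e in edges G) (ev_degree e + 2 * nH) ^ 2)%N.
  by apply: eq_bigr => e eG; rewrite ev_degree_base card_edge.
have copyE : (\sum_(x : G) \sum_(e in edges H)
      ev_degree ((fun u => inr (x, u) : corona G H) @: e) ^ 2 =
    nG * \sum_(e in edges H) (ev_degree e + 1) ^ 2)%N.
  rewrite -sum_nat_const; apply: eq_bigr => x _; apply: eq_bigr => e eH.
  by rewrite ev_degree_copy // -card_gt0 card_edge.
have joinE : (\sum_(x : G) \sum_(u : H)
      ev_degree [set (inl x : corona G H); inr (x, u)] ^ 2 =
    nH * (first_zagreb G + nG * (nH + 1) ^ 2 + 4 * nb_edges G * (nH + 1)))%N.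
  have -> : (4 * nb_edges G * (nH + 1) =
      \sum_(x : G) 2 * (degree x * (nH + 1)))%N.
    by rewrite -big_distrr -big_distrl /= sum_degree; lia.
  have -> : (nG * (nH + 1) ^ 2 = \sum_(x : G) (nH + 1) ^ 2)%N by rewrite sum_nat_const.
  rewrite -!big_split big_distrr /=; apply: eq_bigr => x _.
  by under eq_bigr => u _ do rewrite ev_degree_joining sqrnD; rewrite sum_nat_const.
have := sum_ev_degree_shift G (2 * nH); have := sum_ev_degree_shift H 1.
rewrite [ev_zagreb (corona G H)](sum_edges_corona (fun e => ev_degree e ^ 2)%N) /= baseE copyE joinE.
set SH := (\sum_(e in edges H) _)%N; set SG := (\sum_(e in edges G) _)%N.
move=> eqH eqG.
(* Every vertex of G carries a copy of H, so the identity for H is used n(G)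
times; the rest is linear in the monomials that occur. *)
have := congr1 (muln nG) eqH.
lia.
Qed.
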